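(* Every limit-periodic $V \in \ell^\infty(\mathbb{Z})$ is almost-periodic. Moreover, an almost-periodic $V \in \ell^\infty(\mathbb{Z})$ is limit-periodic if and only if $\mathrm{hull}(V)$ is totally disconnected. Finally, an almost-periodic $V \in \ell^\infty(\mathbb{Z})$ is aperiodic if and only if no point of $\mathrm{hull}(V)$ is isolated.
   Context: The shift $S$ acts on $\ell^\infty(\mathbb{Z})$ by $[SV](n) = V(n+1)$. For $V \in \ell^\infty(\mathbb{Z})$, the orbit of $V$ is $\mathrm{orb}(V) = \{S^k V : k \in \mathbb{Z}\}$, and the hull of $V$, denoted $\mathrm{hull}(V)$, is the closure of $\mathrm{orb}(V)$ in $\ell^\infty(\mathbb{Z})$ with respect to the norm $\|\cdot\|_\infty$; it carries the (metric) topology inherited from $\ell^\infty(\mathbb{Z})$. $V$ is periodic if there is an integer $q \geq 1$ with $V(n+q) = V(n)$ for all $n \in \mathbb{Z}$, and aperiodic if it is not periodic. $V$ is limit-periodic if there are periodic sequences $V_1, V_2, \ldots$ (with possibly different periods) such that $\lim_{n \to \infty} \|V - V_n\|_\infty = 0$; in particular, periodic sequences are limit-periodic. $V$ is almost-periodic if $\mathrm{hull}(V)$ is compact in $\ell^\infty(\mathbb{Z})$; equivalently, if for every $\varepsilon > 0$ there is an $R > 0$ such that for every $k \in \mathbb{Z}$ there exists $\ell \in \mathbb{Z}$ with $|k - \ell| \leq R$ and $\|S^\ell V - V\|_\infty < \varepsilon$. *)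

(* Defs.v *)
From HB Require Import structures.
From mathcomp Require Import all_boot all_order all_algebra.
From mathcomp Require Import complex.
From mathcomp Require Import all_classical all_reals all_analysis.

Set Implicit Arguments.
Unset Strict Implicit.
Unset Printing Implicit Defensive.

Import Order.TTheory GRing.Theory Num.Theory.
Import numFieldNormedType.Exports.

Local Open Scope classical_set_scope.
Local Open Scope ring_scope.

(* The complex numbers as a normed space over R: [Rcomplex R] is [R[i]] with
   scalars restricted to R and norm sqrt (x ^+ 2 + y ^+ 2) valued in R. *)
Section Rcomplex_normedModType.
Variable R : realType.

Lemma Rcomplex_normrZ (l : R) (x : Rcomplex R) : `|l *: x| = `|l| * `|x|.
Proof.
case: x => a b; rewrite /Num.norm /= /ComplexField.Normc.normc /=.
by rewrite !exprMn -mulrDr sqrtrM ?sqr_ge0// sqrtr_sqr.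
Qed.

HB.instance Definition _ :=
  PseudoMetric.copy (Rcomplex R) (pseudoMetric_normed (Rcomplex R)).
HB.instance Definition _ := isPointed.Build (Rcomplex R) 0.
HB.instance Definition _ :=
  NormedZmod_PseudoMetric_eq.Build R (Rcomplex R) erefl.
HB.instance Definition _ :=
  PseudoMetricNormedZmod_Lmodule_isNormedModule.Build R (Rcomplex R)
    Rcomplex_normrZ.

End Rcomplex_normedModType.

(* The entries of a sequence in l^infty(Z) may be real or complex; results are
   stated for both. *)
Variant scalar_kind := RealScalars | ComplexScalars.

Definition scalars (R : realType) (k : scalar_kind) : normedModType R :=
  match k with
  | RealScalars => R
  | ComplexScalars => Rcomplex R
  end.

Section linf.
Variables (R : realType) (E : normedModType R).
Implicit Types f g : int -> E.

Definition linf_pred : {pred (int -> E)} := mem [set f | bounded_fun f].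

Lemma linf_predP f :
  reflect (exists M : R, forall n, `|f n| <= M) (f \in linf_pred).
Proof.
apply: (iffP idP) => [|[M fM]].
  move=> /set_mem [M [_ fM]]; exists (M + 1) => n.
  by apply: fM => //; rewrite ltrDl.
apply/mem_set; exists M; split; first exact: num_real.
by move=> x Mx n _; apply: le_trans (fM n) (ltW Mx).
Qed.

Lemma linf_pred_submod_closed : submod_closed linf_pred.
Proof.
split=> [|a f g /linf_predP[M fM] /linf_predP[N gN]].
  by apply/linf_predP; exists 0 => n; rewrite normr0.
apply/linf_predP; exists (`|a| * M + N) => n.
rewrite (le_trans (ler_normD _ _))// lerD//.
by rewrite normrZ ler_wpM2l.
Qed.

HB.instance Definition _ :=
  GRing.isSubmodClosed.Build R (int -> E) linf_pred linf_pred_submod_closed.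

Record linf := Linf { linf_val :> int -> E; linf_valP : linf_val \in linf_pred }.

HB.instance Definition _ := [isSub for linf_val].
HB.instance Definition _ := [Choice of linf by <:].
HB.instance Definition _ := [SubChoice_isSubLmodule of linf by <:].

Definition linf_norm (V : linf) : R := sup (range (fun n => `|V n|)).

Lemma linf_has_sup (V : linf) : has_sup (range (fun n => `|V n|)).
Proof.
split; first by exists `|V 0|, 0.
by have /linf_predP[M VM] := linf_valP V; exists M => _ [n _ <-].
Qed.

Lemma linf_norm_ub (V : linf) n : `|V n| <= linf_norm V.
Proof. by apply: sup_upper_bound; [exact: linf_has_sup|exists n]. Qed.

Lemma linf_norm_le (V : linf) M : (forall n, `|V n| <= M) -> linf_norm V <= M.
Proof.
by move=> VM; apply: ge_sup; [case: (linf_has_sup V)|move=> _ [n _ <-]].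
Qed.

Lemma linf_normD (V W : linf) : linf_norm (V + W) <= linf_norm V + linf_norm W.
Proof.
apply: linf_norm_le => n; rewrite (le_trans (ler_normD _ _))//.
by rewrite lerD ?linf_norm_ub.
Qed.

Lemma linf_normZ (a : R) (V : linf) : linf_norm (a *: V) = `|a| * linf_norm V.
Proof.
have le_normZ b W : linf_norm (b *: W) <= `|b| * linf_norm W.
  by apply: linf_norm_le => n; rewrite normrZ ler_wpM2l ?linf_norm_ub.
apply/eqP; rewrite eq_le le_normZ /=; have [->|a0] := eqVneq a 0.
  by rewrite normr0 mul0r (le_trans (normr_ge0 _) (linf_norm_ub _ 0)).
have := le_normZ a^-1 (a *: V).
by rewrite scalerA mulVf// scale1r normfV ler_pdivlMl ?normr_gt0.
Qed.

Lemma linf_norm0_eq0 (V : linf) : linf_norm V = 0 -> V = 0.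
Proof.
move=> V0; apply/val_inj/funext => n; apply/normr0_eq0/eqP.
by rewrite eq_le normr_ge0 -V0 linf_norm_ub.
Qed.

HB.instance Definition _ :=
  Lmodule_isNormed.Build R linf linf_normD linf_normZ linf_norm0_eq0.

Lemma linf_normE (V : linf) : `|V| = sup (range (fun n => `|V n|)).
Proof. by []. Qed.

Lemma bshift_subproof (V : linf) : (fun n => V (n + 1)) \in linf_pred.
Proof. by have /linf_predP[M VM] := linf_valP V; apply/linf_predP; exists M. Qed.

Lemma bshiftV_subproof (V : linf) : (fun n => V (n - 1)) \in linf_pred.
Proof. by have /linf_predP[M VM] := linf_valP V; apply/linf_predP; exists M. Qed.

Definition bshift (V : linf) : linf := Linf (bshift_subproof V).

Definition bshiftV (V : linf) : linf := Linf (bshiftV_subproof V).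

Lemma bshiftK : cancel bshift bshiftV.
Proof. by move=> V; apply/val_inj/funext => n /=; rewrite subrK. Qed.

Lemma bshiftVK : cancel bshiftV bshift.
Proof. by move=> V; apply/val_inj/funext => n /=; rewrite addrK. Qed.

Definition bshift_pow (k : int) (V : linf) : linf :=
  match k with
  | Posz m => iter m bshift V
  | Negz m => iter m.+1 bshiftV V
  end.

Lemma bshift_powE k V n : bshift_pow k V n = V (n + k).
Proof.
have iterV m i : iter m bshiftV V i = V (i - m%:Z).
  elim: m i => [|m IH] i; first by rewrite subr0.
  by rewrite iterS /= IH -addrA -opprD intS.
case: k => m /=; last by rewrite iterV NegzE -addrA -opprD intS.
by elim: m n => [|m IH] n; rewrite ?addr0// iterS /= IH -addrA intS.
Qed.

Definition orb (V : linf) : set linf := range (fun k => bshift_pow k V).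

Definition hull (V : linf) : set linf := closure (orb V).

Definition periodic (V : linf) :=
  exists q : int, 1 <= q /\ forall n, V (n + q) = V n.

Definition aperiodic (V : linf) := ~ periodic V.

Definition limit_periodic (V : linf) :=
  exists V_ : nat -> linf,
    (forall n, periodic (V_ n)) /\ `|V - V_ n| @[n --> \oo] --> (0 : R).

Definition almost_periodic (V : linf) := compact (hull V).

End linf.

(* Main.v *)
Require Import Defs.
From HB Require Import structures.
From mathcomp Require Import all_boot all_order all_algebra.
From mathcomp Require Import complex zify.
From mathcomp Require Import all_classical all_reals all_analysis.

(** The powers of the shift act on the hull by isometries.

    If [V] is within [e] of a sequence of period [q], the hull is covered by the
    closures of the [q] sets [{S^(i + q m) V : m}], each of diameter at most
    [2 e]; two of these closures are equal or disjoint, so they are clopen in the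
    hull. Letting [e] tend to [0], the hull is totally bounded (hence compact,
    [linf E] being complete) and totally disconnected.

    Conversely, if the hull is compact and totally disconnected, [V] has a small
    neighbourhood [K] that is clopen in the hull, because quasi-components of
    compact sets are connected. The sets [K] and [hull V `\` K] are at some
    distance [d > 0], and by compactness some [q >= 1] satisfies
    [`|S^q V - V| < d]. Then no power of [S^q] takes [V] out of [K], so
    [n |-> V (n mod q)] is uniformly close to [V].

    An isolated point of the hull lies on the orbit, so [V] itself is isolated
    and recurrence makes it periodic; a periodic [V] has a finite orbit. *)

Set Implicit Arguments.
Unset Strict Implicit.
Unset Printing Implicit Defensive.

Import Order.TTheory GRing.Theory Num.Theory.
Import numFieldNormedType.Exports.

Local Open Scope classical_set_scope.
Local Open Scope ring_scope.

(** * Quasi-components and relatively clopen sets *)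

Section quasi_component.
Context {T : topologicalType}.
Implicit Types A K L W : set T.

(** For closed [A] these are the clopen sets of the subspace [A], described by closed sets of the
    ambient space. *)
Definition rel_clopen A K := [/\ K `<=` A, closed K & closed (A `\` K)].

Lemma rel_clopenI A K L :
  rel_clopen A K -> rel_clopen A L -> rel_clopen A (K `&` L).
Proof.
move=> [KA cK cAK] [LA cL cAL]; split; [by move=> y [/KA]|exact: closedI|].
by rewrite setDIr; exact: closedU.
Qed.

Definition quasi_component A x :=
  [set y | forall K, rel_clopen A K -> K x -> K y].

(** If every relatively clopen [K] containing [x] left [W], the closed sets [K \ W] would generate a
    proper filter on the compact [A]; a cluster point would lie in the quasi-component but outside
    [W]. *)
Lemma rel_clopen_quasi_component A W x : compact A -> closed A -> A x ->
  open W -> quasi_component A x `<=` W ->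
  exists K, [/\ rel_clopen A K, K x & K `<=` W].
Proof.
move=> cA clA Ax oW QW; apply: contrapT => noK.
pose D := [set K | rel_clopen A K /\ K x].
pose F := filter_from D (fun K => K `\` W).
have DA : D A by split => //; split => //; rewrite setDv; exact: closed0.
have FF : Filter F.
  apply: filter_from_filter; first by exists A.
  move=> K L [cK Kx] [cL Lx]; exists (K `&` L).
    by split; [exact: rel_clopenI|].
  by move=> y [[Ky Ly] nWy].
have PF : ProperFilter F.
  apply: filter_from_proper => K [cK Kx]; apply/set0P/negP => /eqP KW0.
  by apply: noK; exists K; split => //; rewrite -setD_eq0.
have FA : F A by exists A => // y [].
have [p [Ap clp]] := cA F PF FA.
have clFp K : D K -> (K `\` W) p.
  move=> DK; have [[_ cK _] _] := DK.
  have : closed (K `\` W) by apply: closedI => //; exact: open_closedC.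
  by apply => B Bp; apply: clp => //; exists K.
have [_] := clFp A DA; apply; apply: QW => K cK Kx.
by have [] := clFp K (conj cK Kx).
Qed.

Lemma quasi_component_closed A x : closed (quasi_component A x).
Proof.
move=> y Qy K cK Kx; have [_ clK _] := cK; apply: clK => B /Qy[z [Qz Bz]].
by exists z; split=> //; exact: Qz.
Qed.

Lemma quasi_component_refl A x : quasi_component A x x.
Proof. by move=> K. Qed.

(** Inside [K] the open sets [U] and [W] are complementary, so [K] meets [U] in the closed set
    [K \ W]. *)
Lemma rel_clopen_split A K U W : rel_clopen A K -> open U -> open W ->
  U `&` W = set0 -> K `<=` U `|` W -> rel_clopen A (K `&` U).
Proof.
move=> [KA clK clAK] oU oW UW0 KUW; split; first by move=> y [/KA].
- suff -> : K `&` U = K `\` W by apply: closedI => //; exact: open_closedC.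
  apply/seteqP; split=> y [Ky]; last by have [] := KUW y Ky.
  by move=> Uy; split => // Wy; have : (U `&` W) y by []; rewrite UW0.
- suff -> : A `\` (K `&` U) = (A `\` K) `|` (K `\` U).
    by apply: closedU => //; apply: closedI => //; exact: open_closedC.
  rewrite setDIr; apply/seteqP; split=> y [|[Ky nUy]]; [by left| |by left|].
    by have [Ky'|nKy] := pselect (K y); [right|left].
  by right; split=> //; exact: KA.
Qed.

End quasi_component.

(** * Compact totally disconnected sets have small clopen neighbourhoods *)

Section totally_disconnected_compact.
Context {R : realType} {T : pseudoMetricType R}.
Implicit Types A K : set T.

(** A clopen part [B] of [Q] and its rest are separated by open [U] and [W]. Some relatively clopen
    [K] around [x] lies in their union; its half containing [x] is again relatively clopen, so it
    contains all of [Q]. *)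
Lemma quasi_component_connected A (x : T) : compact A -> closed A -> A x ->
  connected (quasi_component A x).
Proof.
move=> cA clA Ax B B0 [G oG BG] [C cC BC].
set Q := quasi_component A x in BG BC *.
have clB : closed B.
  by rewrite BC; apply: closedI => //; exact: quasi_component_closed.
have clQB : closed (Q `\` B).
  rewrite BG setDIr setDv set0U; apply: closedI; last exact: open_closedC.
  exact: quasi_component_closed.
have BQB0 : B `&` (Q `\` B) = set0 by rewrite setDE setICA setICr setI0.
have [U [W [oU oW BU QBW UW0]]] :=
  iffLR (@normal_openP R T) pseudometric_normal _ _ clB clQB BQB0.
have QUW : Q `<=` U `|` W.
  by move=> y Qy; have [/BU|nBy] := pselect (B y); [left|right; exact: QBW].
have [K [cK Kx KUW]] := rel_clopen_quasi_component cA clA Ax (openU oU oW) QUW.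
have UWF y : U y -> W y -> False.
  by move=> Uy Wy; have : (U `&` W) y by []; rewrite UW0.
have [Bx|nBx] := pselect (B x).
  rewrite BG; apply/seteqP; split=> [y []//|y Qy]; rewrite -BG.
  have [_ Uy] := Qy _ (rel_clopen_split cK oU oW UW0 KUW) (conj Kx (BU _ Bx)).
  by apply: contrapT => nBy; apply: (UWF y) => //; exact: QBW.
(* If [x] is outside [B], then [W] contains all of [Q], yet [B] has a point, which lies in [U]. *)
have [y By] := B0; have Qy : Q y by move: By; rewrite BG => -[].
rewrite setUC in KUW; rewrite setIC in UW0.
have Wx : W x by apply: QBW; split=> //; exact: quasi_component_refl.
have [_ Wy] := Qy _ (rel_clopen_split cK oW oU UW0 KUW) (conj Kx Wx).
by case: (UWF y) => //; exact: BU.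
Qed.

Lemma totally_disconnected_rel_clopen A (x : T) N : compact A -> closed A ->
  totally_disconnected A -> A x -> nbhs x N ->
  exists K, [/\ rel_clopen A K, K x & K `<=` N].
Proof.
move=> cA clA tdA Ax; rewrite nbhsE => -[G [oG Gx] GN].
have QA : quasi_component A x `<=` A.
  by move=> y; apply => //; split=> //; rewrite setDv; exact: closed0.
have QG : quasi_component A x `<=` G.
  move=> y Qy; suff : connected_component A x y by rewrite tdA// => ->.
  exists (quasi_component A x) => //; split=> //.
  exact: quasi_component_connected.
have [K [cK Kx KG]] := rel_clopen_quasi_component cA clA Ax oG QG.
by exists K; split=> //; exact: subset_trans GN.
Qed.

End totally_disconnected_compact.

(** * Closures and distances in normed spaces *)

Section normed.
Context {R : realType} {E : normedModType R}.
Implicit Types A K L : set E.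

Lemma closure_normP A (x : E) :
  closure A x <-> forall e, 0 < e -> exists2 y, A y & `|x - y| < e.
Proof.
split=> [clx e e0|clx B /nbhs_ballP[e /= e0 eB]].
  have [y [Ay]] := clx _ (nbhsx_ballx x _ e0).
  by rewrite -ball_normE /= => xy; exists y.
have [y Ay xy] := clx e e0; exists y; split=> //; apply: eB.
by rewrite -ball_normE.
Qed.

Lemma compact_closed_dist K L : compact K -> closed L -> K `&` L = set0 ->
  exists2 d, 0 < d & forall x y, K x -> L y -> d <= `|x - y|.
Proof.
move=> /compact_near_coveringP cK clL KL0.
have Hd : \forall d \near 0^'+, K `<=` (fun x => forall y, L y -> d <= `|x - y|).
  apply: cK => x Kx.
  (* If the ball of radius [e] about [x] misses [L], points within [e / 2] of [x] are at distance at
     least [e / 2] from [L]; compactness makes the bound uniform. *)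
  have : nbhs x (~` L).
    apply: open_nbhs_nbhs; split; first exact: closed_openC.
    by move=> Lx; have : (K `&` L) x by []; rewrite KL0.
  move=> /nbhs_ballP[e /= e0 eL].
  exists (ball x (e / 2), [set d | d <= e / 2]) => /=.
    split; first by apply: nbhsx_ballx; rewrite divr_gt0.
    by apply: nbhs_right_le; rewrite divr_gt0.
  move=> [z d] /= [xz de] y Ly; rewrite (le_trans de)// leNgt; apply/negP => zy.
  apply: (eL y _ Ly); rewrite -ball_normE /= -(subrKA z).
  rewrite (le_lt_trans (ler_normD _ _))// [ltRHS]splitr ltrD//.
  by move: xz; rewrite -ball_normE.
have [d [d0 KLd]] := @filter_ex _ (0 : R)^'+ _ _ (filterI (nbhs_right_gt 0) Hd).
by exists d => // x y Kx Ly; exact: KLd.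
Qed.


End normed.

(** * Powers of the shift and recurrence *)

Section shift.
Context {R : realType} {E : normedModType R}.
Implicit Types U V W : linf E.

Lemma linfP U V : (forall n, U n = V n) -> U = V.
Proof. by move=> UV; apply/val_inj/funext. Qed.

Lemma linfBE U V n : (U - V) n = U n - V n.
Proof. by []. Qed.

Lemma bshift_pow0 V : bshift_pow 0 V = V.
Proof. by []. Qed.

Lemma bshift_powD a b V : bshift_pow a (bshift_pow b V) = bshift_pow (a + b) V.
Proof. by apply: linfP => n; rewrite !bshift_powE addrA. Qed.

Lemma bshift_powB k U V : bshift_pow k (U - V) = bshift_pow k U - bshift_pow k V.
Proof. by apply: linfP => n; rewrite linfBE !bshift_powE. Qed.

Lemma norm_bshift_pow k V : `|bshift_pow k V| = `|V|.
Proof.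
have le j W : `|bshift_pow j W| <= `|W|.
  by apply: linf_norm_le => n; rewrite bshift_powE; exact: linf_norm_ub.
by apply/eqP; rewrite eq_le le -{1}[V](bshift_pow0 V) -(addNr k) -bshift_powD le.
Qed.

Lemma bshift_pow_dist k U V :
  `|bshift_pow k U - bshift_pow k V| = `|U - V|.
Proof. by rewrite -bshift_powB norm_bshift_pow. Qed.

Lemma bshift_pow_orb V k : orb V (bshift_pow k V).
Proof. by exists k. Qed.

Lemma orb_hull V : orb V `<=` hull V.
Proof. exact: subset_closure. Qed.

Lemma bshift_pow_hull V k : hull V (bshift_pow k V).
Proof. exact/orb_hull/bshift_pow_orb. Qed.

Lemma hull_closed V : closed (hull V).
Proof. exact: closed_closure. Qed.

Lemma hull_shift V U k : hull V U -> hull V (bshift_pow k U).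
Proof.
move=> /closure_normP hU; apply/closure_normP => e /hU[_ [j _ <-] Uj].
exists (bshift_pow (k + j) V); first by exists (k + j).
by rewrite -bshift_powD bshift_pow_dist.
Qed.

Lemma periodicP V : Defs.periodic V <-> exists q : nat, bshift_pow q.+1%:Z V = V.
Proof.
split=> [[q [q1 qV]]|[q qV]].
  exists `|q|.-1%N; apply: linfP => n; rewrite bshift_powE prednK; last by lia.
  by rewrite gez0_abs; last lia; exact: qV.
by exists q.+1%:Z; split=> [|n]; [lia|rewrite -{2}qV bshift_powE].
Qed.

Lemma bshift_powM (q : int) V : bshift_pow q V = V ->
  forall m, bshift_pow (q * m) V = V.
Proof.
move=> qV m.
have qVn (n : nat) : bshift_pow (q * n%:Z) V = V.
  elim: n => [|n IH]; first by rewrite mulr0.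
  by rewrite intS mulrDr mulr1 -bshift_powD IH.
case: m => n //; rewrite NegzE mulrN -{1}(qVn n.+1) bshift_powD addNr.
exact: bshift_pow0.
Qed.

Lemma bshift_pow_mod (q : int) V k : bshift_pow q V = V ->
  bshift_pow k V = bshift_pow (k %% q)%Z V.
Proof.
move=> qV; rewrite {1}(divz_eq k q) addrC -bshift_powD mulrC bshift_powM//.
Qed.

(** The forward orbit has a cluster point [p]; two times [a < b] at which it is near [p] give the
    return time [b - a], since the shift is an isometry. *)
Lemma almost_periodic_recurrent V e : almost_periodic V -> 0 < e ->
  exists q : nat, `|bshift_pow q.+1%:Z V - V| < e.
Proof.
move=> apV e0.
pose F := (fun n : nat => bshift_pow n%:Z V) @ \oo.
have PF : ProperFilter F by exact: fmap_proper_filter.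
have FV : F (hull V) by exists 0%N => // n _; exact: bshift_pow_hull.
have [p [_ clp]] := apV F PF FV.
have hit N : exists2 n : nat, (N <= n)%N & `|p - bshift_pow n%:Z V| < e / 2.
  have e20 : 0 < e / 2 by rewrite divr_gt0.
  pose tail := [set bshift_pow n%:Z V | n in [set n | (N <= n)%N]].
  have [|_ [[n /= Nn <-]]] := clp tail _ _ (nbhsx_ballx p _ e20).
    by exists N => // n /= Nn; exists n.
  by rewrite -ball_normE /= => pn; exists n.
(* Searching from [a.+1] makes the return time [b - a] positive. *)
have [a _ pa] := hit 0%N; have [b ab pb] := hit a.+1.
exists (b - a.+1)%N.
have -> : (b - a.+1).+1%:Z = - a%:Z + b%:Z by lia.
rewrite -bshift_powD -{2}[V](bshift_pow0 V) -(addNr a%:Z) -bshift_powD.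
rewrite bshift_pow_dist.
rewrite -(subrKA p) [ltRHS]splitr (le_lt_trans (ler_normD _ _))// ltrD//.
by rewrite distrC.
Qed.

(** * From a totally disconnected hull to limit-periodicity *)

Lemma totally_disconnected_limit_periodic V : almost_periodic V ->
  totally_disconnected (hull V) -> limit_periodic V.
Proof.
move=> apV tdV.
have approx e : 0 < e -> exists2 W, Defs.periodic W & `|V - W| <= e.
  move=> e0.
  have hV : hull V V := @bshift_pow_hull V 0.
  have [K [[Kh cK chK] KV Ke]] := totally_disconnected_rel_clopen
    apV (@hull_closed V) tdV hV (nbhsx_ballx V e e0).
  have KhK0 : K `&` (hull V `\` K) = set0 by rewrite setDE setICA setICr setI0.
  have [d d0 Kd] := compact_closed_dist (subclosed_compact cK apV Kh) chK KhK0.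
  have [q qV] := almost_periodic_recurrent apV d0.
  have KM m : K (bshift_pow (m * q.+1%:Z) V).
    (* A step shorter than the gap [d] cannot leave [K]; each application of the shift power or of
       its inverse is such a step. *)
    have stay U W : K U -> hull V W -> `|U - W| < d -> K W.
      move=> KU hW UW; apply: contrapT => nKW.
      by have := Kd _ _ KU (conj hW nKW); rewrite leNgt UW.
    case: m => n.
      elim: n => [|n IH]; first by rewrite mul0r.
      apply: stay IH (@bshift_pow_hull _ _) _.
      rewrite [n.+1%:Z]intS mulrDl mul1r (addrC q.+1%:Z) -bshift_powD.
      by rewrite bshift_pow_dist distrC.
    elim: n => [|n IH].
      apply: stay KV (@bshift_pow_hull _ _) _.
      by rewrite -(bshift_pow_dist q.+1%:Z) bshift_powD mulN1r addrN.
    apply: stay IH (@bshift_pow_hull _ _) _.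
    rewrite !NegzE [n.+2%:Z]intS opprD mulrDl mulN1r.
    rewrite [X in _ - bshift_pow X _]addrC.
    rewrite -bshift_powD bshift_pow_dist -(bshift_pow_dist q.+1%:Z).
    by rewrite bshift_powD addrN.
  pose f n := V (n %% q.+1%:Z)%Z.
  have fb : f \in @linf_pred R E.
    have /linf_predP[M VM] := linf_valP V.
    by apply/linf_predP; exists M => n; exact: VM.
  exists (Linf fb).
    by exists q.+1%:Z; split=> // n; rewrite /= /f modzDr.
  apply: linf_norm_le => n; rewrite linfBE /= /f.
  (* As [n = m + r], the entry at [n] of the difference to bound is, up to sign, the entry of
     [V - bshift_pow m V] at [r]. *)
  set r := (n %% _)%Z; set m := (n %/ q.+1%:Z)%Z * q.+1%:Z.
  have /Ke : K (bshift_pow m V) by exact: KM.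
  rewrite -ball_normE /= => /ltW; apply: le_trans.
  rewrite distrC; have := linf_norm_ub (V - bshift_pow m V) r.
  by rewrite linfBE bshift_powE (addrC r) /m /r -divz_eq.
have /choice[W_ HW] (n : nat) :
    exists W, Defs.periodic W /\ `|V - W| <= n.+1%:R^-1.
  have [|W pW VW] := approx n.+1%:R^-1; [by rewrite invr_gt0|by exists W].
exists W_; split=> [n|]; first by have [] := HW n.
apply: (@squeeze_cvgr _ _ _ _ (cst 0) (@harmonic R));
  [|exact: cvg_cst|exact: cvg_harmonic].
by apply: nearW => n; rewrite normr_ge0/=; have [] := HW n.
Qed.

End shift.

(** * Isolated points of the hull and periodicity *)

Section hull.
Context {R : realType} {E : normedModType R}.
Implicit Types U V W : linf E.

Lemma aperiodic_hull_not_isolated V : almost_periodic V -> aperiodic V ->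
  forall W, hull V W -> ~ isolated (hull V) W.
Proof.
move=> apV nV W hW [_ [N /nbhs_ballP[e /= e0 eN] NW]].
have isoW U : hull V U -> `|W - U| < e -> U = W.
  move=> hU WU; suff : (N `&` hull V) U by rewrite NW.
  by split=> //; apply: eN; rewrite -ball_normE.
(* The ball of radius [e] about [W] meets the orbit, but meets the hull only in [W]; hence [W] lies
   on the orbit. *)
have [_ [j _ <-] Wj] := iffLR (closure_normP _ _) hW _ e0.
have WE : W = bshift_pow j V by apply/esym/isoW => //; exact: bshift_pow_hull.
have [q qV] := almost_periodic_recurrent apV e0.
apply: nV; apply/periodicP; exists q.
have /isoW : hull V (bshift_pow q.+1%:Z W) by exact: hull_shift.
rewrite WE bshift_powD (addrC q.+1%:Z) -bshift_powD bshift_pow_dist distrC.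
move=> /(_ qV) /(congr1 (bshift_pow (- j))); rewrite !bshift_powD !addNr add0r.
by rewrite bshift_pow0.
Qed.

Lemma periodic_orb_finite V : Defs.periodic V -> finite_set (orb V).
Proof.
move=> /periodicP[q qV].
apply: (@sub_finite_set _ _ ((fun i : nat => bshift_pow i%:Z V) @` `I_q.+1)).
  move=> _ [k _ <-]; exists `|(k %% q.+1%:Z)%Z|%N.
    rewrite /=; have := @ltz_pmod k q.+1%:Z isT.
    by have := @modz_ge0 k q.+1%:Z isT; lia.
  by rewrite gez0_abs ?modz_ge0// -bshift_pow_mod.
exact/finite_image/finite_II.
Qed.

Lemma periodic_isolated V : Defs.periodic V -> isolated (hull V) V.
Proof.
move=> /periodic_orb_finite fV.
have fcl (A : set (linf E)) : finite_set A -> closed A.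
  apply: (iffLR accessible_finite_set_closed).
  exact/hausdorff_accessible/norm_hausdorff.
have hV : hull V = orb V by rewrite /hull -(closure_id _).1//; exact: fcl.
split; first by apply/mem_set; exact: (@bshift_pow_hull _ _ V 0).
(* The other points of the orbit are finitely many, so their complement is open. *)
exists (~` (orb V `\ V)).
  apply: open_nbhs_nbhs; split; last by move=> [_]; apply.
  by apply: closed_openC; apply: fcl; exact: finite_setD.
rewrite hV; apply/seteqP; split=> [U [nU oU]|_ ->]; last first.
  by split; [move=> [_]; apply|exact: (@bshift_pow_orb _ _ V 0)].
by apply: contrapT => UV; apply: nU.
Qed.

(** * Residue classes in the hull of a limit-periodic sequence *)

Lemma limit_periodic_approx V e : limit_periodic V -> 0 < e ->
  exists2 W, Defs.periodic W & `|V - W| < e.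
Proof.
move=> [W [pW VW]] e0.
have [n _ Hn] := cvgr_lt _ VW _ e0.
by exists (W n) => //; exact: (Hn n (leqnn n)).
Qed.

(** The orbit closure of [bshift_pow i V] under the [q]-th power of the shift. *)
Definition shift_coset (V : linf E) (q : nat) (i : nat) : set (linf E) :=
  closure (range (fun m => bshift_pow (i%:Z + q%:Z * m) V)).

(** Near a common point [U] both cosets have orbit points, of indices [i + q a] and [j + q b].
    Shifting both by [q (m - a)] brings the first to a given index [i + q m] and keeps their
    distance. *)
Lemma shift_coset_subset V q i j U :
  shift_coset V q i U -> shift_coset V q j U ->
  shift_coset V q i `<=` shift_coset V q j.
Proof.
move=> /closure_normP iU /closure_normP jU P /closure_normP iP.
apply/closure_normP => e e0.
have e2 : 0 < e / 2 by rewrite divr_gt0.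
have e4 : 0 < e / 2 / 2 by rewrite divr_gt0.
have [_ [m _ <-] Pm] := iP _ e2.
have [_ [a _ <-] Ua] := iU _ e4.
have [_ [b _ <-] Ub] := jU _ e4.
exists (bshift_pow (j%:Z + q%:Z * (b + (m - a))) V).
  by exists (b + (m - a)).
rewrite -(subrKA (bshift_pow (i%:Z + q%:Z * m) V)) [ltRHS]splitr.
rewrite (le_lt_trans (ler_normD _ _))// ltrD//.
have -> : i%:Z + q%:Z * m = q%:Z * (m - a) + (i%:Z + q%:Z * a) by lia.
have -> : j%:Z + q%:Z * (b + (m - a)) = q%:Z * (m - a) + (j%:Z + q%:Z * b).
  by lia.
rewrite -!(bshift_powD (q%:Z * (m - a))) bshift_pow_dist.
rewrite -(subrKA U) [ltRHS]splitr (le_lt_trans (ler_normD _ _))// ltrD//.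
by rewrite distrC.
Qed.

Lemma hull_shift_coset V q U : (0 < q)%N -> hull V U ->
  exists2 i, (i < q)%N & shift_coset V q i U.
Proof.
move=> q0 hU.
have cl : closed (\bigcup_(i in `I_q) shift_coset V q i).
  by apply: closed_bigcup => [|i _]; [exact: finite_II|exact: closed_closure].
suff : hull V `<=` \bigcup_(i in `I_q) shift_coset V q i.
  by move=> /(_ U hU) [j jq jU]; exists j.
rewrite [X in _ `<=` X](closure_id _).1//; apply: closureS => _ [k _ <-].
exists `|(k %% q%:Z)%Z|%N.
  by rewrite /=; have := @ltz_pmod k q%:Z; have := @modz_ge0 k q%:Z; lia.
apply: subset_closure; exists (k %/ q%:Z)%Z => //.
have kq0 : (0 <= k %% q%:Z)%Z by apply: modz_ge0; lia.
by rewrite gez0_abs// mulrC addrC -divz_eq.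
Qed.

(** Shifts by [i + q m] send [W] to [bshift_pow i W] for every [m]; the bound then passes to the
    closure. *)
Lemma shift_coset_dist V W q i U e : bshift_pow q%:Z W = W -> `|V - W| <= e ->
  shift_coset V q i U -> `|U - bshift_pow i%:Z W| <= e.
Proof.
move=> qW VW /closure_normP iU; apply/ler_addgt0Pl => d /iU[_ [m _ <-] Ud].
rewrite -(subrKA (bshift_pow (i%:Z + q%:Z * m) V)).
rewrite (le_trans (ler_normD _ _))// lerD// ?(ltW Ud)//.
by rewrite -{1}(bshift_powM qW m) bshift_powD bshift_pow_dist.
Qed.

Lemma limit_periodic_totally_disconnected V : limit_periodic V ->
  totally_disconnected (hull V).
Proof.
move=> lpV x hx; apply/seteqP; split=> [y [C [Cx Ch cC] Cy]|_ ->]; last first.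
  exact: connected_component_refl.
suff yx e : 0 < e -> `|y - x| <= e.
  apply/eqP; rewrite -subr_eq0 -normr_le0; apply/ler_addgt0Pl => e e0.
  by rewrite addr0 yx.
move=> e0; have e2 : 0 < e / 2 by rewrite divr_gt0.
have [W /periodicP[q qW] /ltW VW] := limit_periodic_approx lpV e2.
have [j _ jx] := hull_shift_coset (ltn0Sn q) hx.
pose H i := shift_coset V q.+1 i.
have CjE : C `&` H j = C.
  apply: cC; first by exists x.
    (* Within the hull, [H j] is the complement of the finitely many closed cosets disjoint from it,
       hence relatively open. *)
    pose I := [set i | (i < q.+1)%N /\ H i `&` H j = set0].
    exists (~` (\bigcup_(i in I) H i)).
      apply/closed_openC/closed_bigcup => [|i _]; last exact: closed_closure.
      by apply: (sub_finite_set _ (finite_II q.+1)) => i [].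
    apply/seteqP; split=> z [Cz].
      move=> jz; split=> // -[i [_ ij0] iz].
      by have : (H i `&` H j) z by []; rewrite ij0.
    move=> nz; split=> //; have [i iq iz] := hull_shift_coset (ltn0Sn q) (Ch _ Cz).
    have [|/set0P[w [iw jw]]] := eqVneq (H i `&` H j) set0.
      by move=> ij0; case: nz; exists i.
    exact: (shift_coset_subset iw jw).
  by exists (H j) => //; exact: closed_closure.
have jy : H j y by move: Cy; rewrite -CjE => -[].
(* Both [x] and [y] lie within [e / 2] of [bshift_pow j W]. *)
rewrite -(subrKA (bshift_pow j%:Z W)) [leRHS]splitr (le_trans (ler_normD _ _))//.
by rewrite lerD//; [|rewrite distrC]; exact: (shift_coset_dist qW VW).
Qed.

(** * Completeness of [linf E] and compactness of the hull *)

Lemma linf_complete :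
  (forall F : set_system E, ProperFilter F -> cauchy F -> cvg F) ->
  forall F : set_system (linf E), ProperFilter F -> cauchy F -> cvg F.
Proof.
move=> E_complete F PF /cauchyP cF.
have /choice[w Fw] n : exists w : E, (fun V : linf E => V n) @ F --> w.
  exists (lim ((fun V : linf E => V n) @ F)).
  apply: E_complete; apply/cauchy_exP => e /cF[U FU]; exists (U n).
  apply: (@filterS _ F _ (ball U e) _ _ FU) => V.
  rewrite /= -!ball_normE /=; apply: le_lt_trans.
  by rewrite -linfBE; exact: linf_norm_ub.
(* The limit [w] is built entrywise; bounds uniform in [n] survive the entrywise limit and give
   convergence in norm. *)
have wU e U : F (ball U e) -> forall n, `|w n - U n| <= e.
  move=> FU n; apply/ler_addgt0Pl => d d0.
  have [V [UV wV]] := filter_ex (filterI FU (cvgr_dist_lt _ _ (Fw n) _ d0)).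
  rewrite -(subrKA (V n)) (le_trans (ler_normD _ _))// lerD//; first exact: ltW.
  move: UV; rewrite -ball_normE /= distrC => /ltW; apply: le_trans.
  by rewrite -linfBE; exact: linf_norm_ub.
have wb : w \in @linf_pred R E.
  have [U FU] := cF 1 ltr01; apply/linf_predP; exists (1 + `|U|) => n.
  rewrite -(subrK (U n) (w n)) (le_trans (ler_normD _ _))// lerD//; first exact: wU.
  exact: linf_norm_ub.
apply: (cvgP (Linf wb)); apply/cvgrPdist_le => e e0.
have [|U FU] := cF (e / 2); first by rewrite divr_gt0.
apply: filterS (FU) => V; rewrite -ball_normE /= => /ltW UV.
rewrite -(subrKA U) [leRHS]splitr (le_trans (ler_normD _ _))// lerD//.
by apply: linf_norm_le => n; rewrite linfBE; exact: wU.
Qed.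

Lemma limit_periodic_almost_periodic V :
  (forall F : set_system E, ProperFilter F -> cauchy F -> cvg F) ->
  limit_periodic V -> almost_periodic V.
Proof.
move=> E_complete lpV; rewrite /almost_periodic compact_ultra => F UF FV.
(* By completeness it is enough that an ultrafilter containing the hull is Cauchy. *)
suff /(linf_complete E_complete) cF : cauchy F.
  exists (lim F); split; last exact: cF.
  exact: (closed_cvg _ (@hull_closed _ _ V) FV).
apply/cauchy_exP => e e0; have e2 : 0 < e / 2 by rewrite divr_gt0.
have [W /periodicP[q qW] /ltW VW] := limit_periodic_approx lpV e2.
apply: contrapT => noF.
(* Containing no ball of radius [e], the ultrafilter contains the complements of the balls about the
   shifts of [W]; but these finitely many balls cover the hull. *)
have noW (i : 'I_q.+1) : \forall U \near F, ~ ball (bshift_pow i%:Z W) e U.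
  have [FB|//] := in_ultra_setVsetC (ball (bshift_pow i%:Z W) e) UF.
  by case: noF; exists (bshift_pow i%:Z W).
have [U [hU noU]] := filter_ex (filterI FV (filter_forall _ noW)).
have [i iq iU] := hull_shift_coset (ltn0Sn q) hU.
apply: (noU (Ordinal iq)); rewrite -ball_normE /= distrC.
by rewrite (le_lt_trans (shift_coset_dist qW VW iU))// ltr_pdivrMr//
  ltr_pMr// ltr1n.
Qed.

End hull.

(** * Completeness of the real and complex scalars *)

Section scalars.
Context {R : realType}.
Implicit Types z w : Rcomplex R.

Lemma Rcomplex_normE z :
  `|z| = Num.sqrt (complex.Re z ^+ 2 + complex.Im z ^+ 2).
Proof. by case: z. Qed.

Lemma Rcomplex_ReB z w : complex.Re (z - w) = complex.Re z - complex.Re w.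
Proof. by case: z w => [? ?] [? ?]. Qed.

Lemma Rcomplex_ImB z w : complex.Im (z - w) = complex.Im z - complex.Im w.
Proof. by case: z w => [? ?] [? ?]. Qed.

Lemma norm_Re_le z : `|complex.Re z| <= `|z|.
Proof.
by rewrite Rcomplex_normE -sqrtr_sqr ler_wsqrtr// lerDl sqr_ge0.
Qed.

Lemma norm_Im_le z : `|complex.Im z| <= `|z|.
Proof.
by rewrite Rcomplex_normE -sqrtr_sqr ler_wsqrtr// lerDr sqr_ge0.
Qed.

Lemma Rcomplex_norm_le z : `|z| <= `|complex.Re z| + `|complex.Im z|.
Proof.
rewrite Rcomplex_normE -[leRHS]ger0_norm ?addr_ge0// -sqrtr_sqr ler_wsqrtr//.
rewrite sqrrD !real_normK ?num_real// addrAC lerDl.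
by rewrite mulrn_wge0// mulr_ge0.
Qed.

(** Real and imaginary parts are 1-Lipschitz, so both converge, and [Rcomplex_norm_le] recombines
    the limits. *)
Lemma Rcomplex_complete (F : set_system (Rcomplex R)) :
  ProperFilter F -> cauchy F -> cvg F.
Proof.
move=> PF /cauchyP cF.
have cRe : cvg ((fun z : Rcomplex R => complex.Re z) @ F).
  apply: cauchy_cvg; apply/cauchy_exP => e /cF[z Fz]; exists (complex.Re z).
  apply: (@filterS _ F _ (ball z e) _ _ Fz) => w.
  rewrite /= -!ball_normE /=; apply: le_lt_trans.
  by rewrite -Rcomplex_ReB; exact: norm_Re_le.
have cIm : cvg ((fun z : Rcomplex R => complex.Im z) @ F).
  apply: cauchy_cvg; apply/cauchy_exP => e /cF[z Fz]; exists (complex.Im z).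
  apply: (@filterS _ F _ (ball z e) _ _ Fz) => w.
  rewrite /= -!ball_normE /=; apply: le_lt_trans.
  by rewrite -Rcomplex_ImB; exact: norm_Im_le.
set a := lim _ in cRe; set b := lim _ in cIm.
apply: (cvgP (Complex a b : Rcomplex R)); apply/cvgrPdist_lt => e e0.
have e2 : 0 < e / 2 by rewrite divr_gt0.
apply: filterS (filterI (cvgr_dist_lt _ _ cRe _ e2) (cvgr_dist_lt _ _ cIm _ e2)).
move=> w [aw bw]; rewrite (le_lt_trans (Rcomplex_norm_le _))// [ltRHS]splitr.
by rewrite Rcomplex_ReB Rcomplex_ImB ltrD.
Qed.

Lemma scalars_complete k (F : set_system (scalars R k)) :
  ProperFilter F -> cauchy F -> cvg F.
Proof.
case: k F => F PF cF; [exact: (@cauchy_cvg R)|exact: Rcomplex_complete].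
Qed.

End scalars.

Theorem proposition3p3 (R : realType) (k : scalar_kind) :
  (forall V : linf (scalars R k), limit_periodic V -> almost_periodic V) /\
  (forall V : linf (scalars R k), almost_periodic V ->
     (limit_periodic V <-> totally_disconnected (hull V))) /\
  (forall V : linf (scalars R k), almost_periodic V ->
     (aperiodic V <-> forall W, hull V W -> ~ isolated (hull V) W)).
Proof.
split=> [V|].
  by apply: limit_periodic_almost_periodic; exact: scalars_complete.
split=> V apV; split.
- exact: limit_periodic_totally_disconnected.
- exact: totally_disconnected_limit_periodic.
- exact: aperiodic_hull_not_isolated.
- move=> noiso /periodic_isolated; apply: noiso.
  exact: (@bshift_pow_hull _ _ V 0).
Qed.
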